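(* Let $X$ be a metrizable topological vector space over $\mathbb{K}=\mathbb{R}$ or $\mathbb{C}$ which admits a continuous norm $\|\cdot\|$, and let $\mathcal{X}=(x_{n,k})_{n\geq k\geq 0}$ be a family of elements of $X$ such that $(x_{n,k})_{n\geq k}$ converges in $X$ for every $k\geq 0$. For $l\geq 1$ let $E_l$ be the set of all $b\in X$ for which there exist $(n,m)\in\mathbb{N}^2$ with $n>m\geq l$ and scalars $b_l,b_{l+1},\dots,b_m,\dots,b_n\in\mathbb{K}$ such that $$b=\sum_{j=l}^m b_j x_{m,j}\quad\text{and}\quad \sum_{j=l}^m b_j x_{n,j}=\sum_{j=m+1}^n b_j x_{n,j}.$$ If there exists $l\geq 1$ such that $E_l$ is not dense in $X$, then $\mathcal{U}(\mathcal{X})\cap\mathbb{K}^{\mathbb{N}}$ is not spaceable.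
   Context: $\mathbb{K}^{\mathbb{N}}$ carries the Cartesian (product) topology. $\mathcal{U}(\mathcal{X})\cap\mathbb{K}^{\mathbb{N}}$ is the set of sequences $a=(a_k)_{k\geq 0}\in\mathbb{K}^{\mathbb{N}}$ such that $\left\{\sum_{k=0}^n a_k x_{n,k}:\ n\geq 0\right\}$ is dense in $X$. A subset of $\mathbb{K}^{\mathbb{N}}$ is spaceable if it contains, apart from $0$, a closed infinite-dimensional subspace of $\mathbb{K}^{\mathbb{N}}$. *)

(* Defs.v *)
From HB Require Import structures.
From mathcomp Require Import all_boot all_order all_algebra.
From mathcomp Require Import complex.
From mathcomp Require Import all_classical all_reals all_analysis.
Set Implicit Arguments.
Unset Strict Implicit.
Unset Printing Implicit Defensive.
Import Order.TTheory GRing.Theory Num.Theory.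
Import numFieldNormedType.Exports.
Local Open Scope classical_set_scope.
Local Open Scope ring_scope.

(* The library's tvsType is locally convex, which is not wanted here: a general
   topological vector space is a topologicalLmodType, and metrizability is the
   following property of its topology. *)
Definition metrizable (R : realType) (T : topologicalType) : Prop :=
  exists d : T -> T -> R,
    [/\ forall x y, 0 <= d x y,
        forall x y, d x y = 0 <-> x = y,
        forall x y, d x y = d y x,
        forall x y z, d x z <= d x y + d y z &
        forall (x : T) (A : set T),
          nbhs x A <-> exists2 e : R, 0 < e & [set y | d x y < e] `<=` A].

(* As everywhere in MathComp, norms are valued in the scalar field K; when
   K = R[i], 0 <= z forces z to be real. *)
Definition continuous_norm (K : numFieldType) (X : topologicalLmodType K)
    (N : X -> K) : Prop :=
  [/\ forall x, 0 <= N x,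
      forall x, N x = 0 -> x = 0,
      forall (a : K) x, N (a *: x) = `|a| * N x,
      forall x y, N (x + y) <= N x + N y &
      continuous N].

(* K^N, with the product topology and the pointwise vector space structure. *)
Definition seq_space (K : numFieldType) : Type := {ptws nat -> K^o}.

HB.instance Definition _ (K : numFieldType) :=
  Topological.copy (seq_space K) {ptws nat -> K^o}.
HB.instance Definition _ (K : numFieldType) :=
  GRing.Lmodule.copy (seq_space K) (nat -> K^o).

Section Spaceability.
Variables (K : numFieldType) (E : preTopologicalLmodType K).

Definition finite_dimensional (F : set E) : Prop :=
  exists (n : nat) (v : 'I_n -> E),
    (forall i, F (v i)) /\
    (forall y, F y -> exists c : 'I_n -> K, y = \sum_i c i *: v i).

Definition spaceable (A : set E) : Prop :=
  exists F : set E,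
    [/\ submod_closed (mem F), closed F, ~ finite_dimensional F &
        F `\ 0 `<=` A].

End Spaceability.

Section Family.
Variables (K : numFieldType) (X : topologicalLmodType K).
(* A family indexed by n >= k is given by a total function of n and k, of which
   only the values x n k with k <= n matter below. *)
Variable x : nat -> nat -> X.

Definition universal_seqs : set (seq_space K) :=
  [set a | dense (range (fun n : nat => \sum_(0 <= k < n.+1) a k *: x n k))].

Definition E_ (l : nat) : set X :=
  [set b | exists (n m : nat) (c : nat -> K),
    [/\ (l <= m < n)%N,
        b = \sum_(l <= j < m.+1) c j *: x m j &
        \sum_(l <= j < m.+1) c j *: x n j =
          \sum_(m.+1 <= j < n.+1) c j *: x n j]].

End Family.

(* Main.v *)
Require Import Defs.
From HB Require Import structures.
From mathcomp Require Import all_boot all_order all_algebra.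
From mathcomp Require Import complex.
From mathcomp Require Import all_classical all_reals all_analysis.
Import Order.TTheory GRing.Theory Num.Theory.
Import numFieldNormedType.Exports.
Local Open Scope classical_set_scope.
Local Open Scope ring_scope.

Set Implicit Arguments.
Unset Strict Implicit.

(** Suppose [F] witnesses spaceability and [E_ x l] misses a nonempty open set
    [W]. If [f] in [F] has no coordinates below [l] and its [m]-th partial sum
    lies in [W], then no later partial sum of [f] vanishes, since otherwise the
    [m]-th one would belong to [E_ x l]. As [F] is infinite-dimensional and made
    of universal sequences, there are such [f_k], [m_k] with [f_(k+1)] supported
    beyond [m_k]. Every series of multiples [c_k f_k] converges coordinatewise,
    so the [c_k] may be taken as large as one likes: choosing them one after
    the other, one forces [c_0 f_0 + ... + c_k f_k] to have [n]-th partial sum of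
    norm at least [1] whenever [n <= m_(k+1)] and the [n]-th partial sum of [f_k] is
    nonzero. At each order [n > m_0] the last of the [f_k] with a nonzero [n]-th
    partial sum then decides, and the sum of the series is an element of [F]
    whose partial sums do not approach [0]. *)

Section PartialSums.
Variables (K : numFieldType) (X : topologicalLmodType K) (x : nat -> nat -> X).

Definition partial_sum (n : nat) (a : seq_space K) : X :=
  \sum_(0 <= k < n.+1) a k *: x n k.

Lemma eq_partial_sum n (a b : seq_space K) :
  (forall k, (k <= n)%N -> a k = b k) -> partial_sum n a = partial_sum n b.
Proof. by move=> eqab; apply: eq_big_nat => k /andP[_ /eqab ->]. Qed.

Lemma partial_sumD n (a b : seq_space K) (c : K) :
  partial_sum n (a + c *: b) = partial_sum n a + c *: partial_sum n b.
Proof.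
rewrite /partial_sum scaler_sumr -big_split /=; apply: eq_bigr => k _.
by rewrite scalerA -scalerDl.
Qed.

Lemma partial_sum0 n : partial_sum n 0 = 0.
Proof. by apply: big1 => k _; rewrite scale0r. Qed.

Lemma partial_sum_below n (a : seq_space K) :
  (forall k, (k <= n)%N -> a k = 0) -> partial_sum n a = 0.
Proof. by move=> a0; rewrite -(partial_sum0 n); apply: eq_partial_sum. Qed.

Lemma partial_sum_from l n (a : seq_space K) :
  (forall k, (k < l)%N -> a k = 0) -> (l <= n.+1)%N ->
  partial_sum n a = \sum_(l <= k < n.+1) a k *: x n k.
Proof.
move=> a0 ln; rewrite /partial_sum (@big_cat_nat _ _ _ l) //=.
rewrite big_nat big1 ?add0r //.
by move=> k /andP[_ /a0 ->]; rewrite scale0r.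
Qed.

Lemma E_0 l : E_ x l 0.
Proof.
by exists l.+1, l, (fun=> 0); split; rewrite ?leqnn ?ltnSn //;
   rewrite !big1 // => j _; rewrite scale0r.
Qed.

(** Cutting the vanishing [n]-th sum after [m] gives two opposite pieces; changing the sign of the
    coefficients beyond [m] makes them equal and leaves the [m]-th sum intact. *)
Lemma E_partial_sum l m n (a : seq_space K) :
  (forall k, (k < l)%N -> a k = 0) -> (l <= m < n)%N ->
  partial_sum n a = 0 -> E_ x l (partial_sum m a).
Proof.
move=> a0 /andP[lm mn] an0.
exists n, m, (fun j => if (j <= m)%N then a j else - a j); split.
- by rewrite lm mn.
- rewrite (partial_sum_from a0) ?leqW//; apply: eq_big_nat => j /andP[_].
  by rewrite ltnS => ->.
- move: an0; rewrite (partial_sum_from a0); last first.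
    by rewrite leqW// (leq_trans lm)// ltnW.
  rewrite (@big_cat_nat _ _ _ m.+1) ?leqW //=.
  move/eqP; rewrite addr_eq0 => /eqP eqS.
  transitivity (\sum_(l <= j < m.+1) a j *: x n j).
    by apply: eq_big_nat => j /andP[_]; rewrite ltnS => ->.
  rewrite eqS -sumrN; apply: eq_big_nat => j /andP[mj _].
  by rewrite leqNgt mj /= scaleNr.
Qed.

End PartialSums.

Section ContinuousNorm.
Variables (K : numFieldType) (X : topologicalLmodType K) (N : X -> K).
Hypothesis hN : continuous_norm N.

Lemma continuous_norm_gt0 u : u != 0 -> 0 < N u.
Proof.
case: hN => N_ge0 N_eq0 _ _ _ u0; rewrite lt_def N_ge0 andbT.
by apply: contra_neq u0 => /N_eq0.
Qed.

Lemma continuous_normN u : N (- u) = N u.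
Proof. by case: hN => _ _ NZ _ _; rewrite -scaleN1r NZ normrN1 mul1r. Qed.

Lemma le_continuous_norm_add (c : K) (u v : X) :
  0 <= c -> c * N v - N u <= N (u + c *: v).
Proof.
case: hN => _ _ NZ ND _ c0; rewrite lerBlDr.
rewrite -{1}(ger0_norm c0) -NZ -[X in N X <= _](addKr u) addrC.
by rewrite -(continuous_normN u) ND.
Qed.

(* Here [0^-1 = 0], so that the indices with [v i = 0] contribute nothing. *)
Definition dominating_coef (B : nat) (u v : nat -> X) : K :=
  \sum_(i < B.+1) (1 + N (u i)) / N (v i).

Lemma dominating_coefP B (u v : nat -> X) n : (n <= B)%N -> v n != 0 ->
  1 <= N (u n + dominating_coef B u v *: v n).
Proof.
case: (hN) => N_ge0 _ _ _ _ nB vn0.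
have term_ge0 i : 0 <= (1 + N (u i)) / N (v i) by rewrite divr_ge0// addr_ge0.
have c0 : 0 <= dominating_coef B u v by apply: sumr_ge0.
apply: le_trans (le_continuous_norm_add _ _ c0); rewrite lerBrDr.
rewrite -ler_pdivrMr ?continuous_norm_gt0//.
rewrite /dominating_coef (bigD1 (Ordinal (nB : n < B.+1)%N)) //=.
by rewrite lerDl sumr_ge0.
Qed.

(** Norm values are real, so [0 < N u < r] says that [N u] lies in the ball of [K] with centre and
    radius [r / 2]. *)
Lemma open_continuous_norm_ball (r : K) :
  0 < r -> open [set u | 0 < N u < r].
Proof.
case: hN => N_ge0 _ _ _ Nc r0.
have ballE u : (`|r / 2 - N u| < r / 2) = (0 < N u < r).
  rewrite distrC real_ltr_distl ?subrr -?splitr//.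
  by rewrite realB ?ger0_real// divr_ge0// ltW.
suff -> : [set u | 0 < N u < r] = N @^-1` ball (r / 2) (r / 2).
  by apply: open_comp => [? _|]; [exact: Nc|exact: ball_open].
by apply/seteqP; split=> u; rewrite /= -ball_normE /= ballE.
Qed.

End ContinuousNorm.

Section SequenceSpace.
Variable K : numFieldType.

Lemma submod_closedP (E : lmodType K) (F : set E) : submod_closed (mem F) <->
  F 0 /\ forall (a : K) u v, F u -> F v -> F (a *: u + v).
Proof.
split=> -[F0 FL]; split.
- by move: F0; rewrite inE.
- by move=> a u v Fu Fv; have := FL a u v; rewrite !inE; apply.
- by rewrite inE.
- by move=> a u v; rewrite !inE; exact: FL.
Qed.

(** Used contrapositively, to find nonzero elements of an infinite-dimensional subspace that vanish
    on a given initial segment. In the induction, the kernel of coordinate [p] has codimension at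
    most one in [F]. *)
Lemma finite_dimensional_coordinates (F : set (seq_space K)) (p : nat) :
  submod_closed (mem F) ->
  (forall a, F a -> (forall k, (k < p)%N -> a k = 0) -> a = 0) ->
  finite_dimensional F.
Proof.
elim: p F => [|p IHp] F /submod_closedP[F0 FL] inj.
  exists 0, (fun=> 0); split=> [[]//|y Fy]; exists (fun=> 0).
  by rewrite big_ord0; apply: inj.
have [n [v [Fv spanv]]] : finite_dimensional (F `&` [set a | a p = 0]).
  apply: IHp => [|a [Fa ap0] a0]; last first.
    apply: inj => // k; rewrite ltnS leq_eqVlt => /predU1P[->//|]; exact: a0.
  apply/submod_closedP; split=> // a u w [Fu up0] [Fw wp0].
  split; first exact: FL.
  by rewrite /= [LHS](_ : _ = a * u p + w p)// up0 wp0 mulr0 addr0.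
have [[e Fe ep]|noe] := pselect (exists2 e, F e & e p <> 0); last first.
  exists n, v; split=> [i|y Fy]; first by have [] := Fv i.
  by apply: spanv; split=> //; apply: contrapT => yp; apply: noe; exists y.
exists n.+1, (fun i => if unlift ord0 i is Some j then v j else e); split.
  by move=> i; case: unliftP => [j _|_//]; have [] := Fv j.
move=> y Fy.
have [|c yE] := spanv (- (y p / e p) *: e + y).
  split; first exact: FL.
  rewrite /= [LHS](_ : _ = - (y p / e p) * e p + y p)// mulNr.
  by rewrite divfK ?addNr//; apply/eqP.
exists (fun i => if unlift ord0 i is Some j then c j else y p / e p).
rewrite big_ord_recl unlift_none; under eq_bigr do rewrite liftK.
by rewrite -yE scaleNr addNKr.
Qed.

Lemma cvg_seq_space_coordinates (g : nat -> seq_space K) (f : seq_space K) :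
  (forall k i, (k < i)%N -> g i k = f k) -> g i @[i --> \oo] --> f.
Proof.
move=> gE; apply/(@pointwise_cvgP nat K^o) => k.
apply: (@cvg_near_cst nat K^o (f k) (fun i => g i k)); near=> i.
by apply: gE; near: i; exact: nbhs_infty_gt.
Unshelve. all: by end_near.
Qed.

End SequenceSpace.

Section GlidingHump.
Variables (K : numFieldType) (X : topologicalLmodType K) (x : nat -> nat -> X).
Variables (N : X -> K) (hN : continuous_norm N).
Variables (f : nat -> seq_space K) (m : nat -> nat).

(** The coefficient of [f i] is effective up to order [m i.+1], beyond which the partial sums of
    [f i.+1] no longer vanish and can take over. *)
Fixpoint hump (k : nat) : seq_space K :=
  if k is i.+1 then
    hump i + dominating_coef N (m k) (fun n => partial_sum x n (hump i))
               (fun n => partial_sum x n (f i)) *: f i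
  else 0.

Hypothesis m_incr : forall k, (m k < m k.+1)%N.
Hypothesis f_supp : forall k j, (j <= m k)%N -> f k.+1 j = 0.
Hypothesis f_sum : forall k n, (m k < n)%N -> partial_sum x n (f k) != 0.

Lemma hump_norm_ge1 k n :
  (m 0 < n <= m k)%N -> 1 <= N (partial_sum x n (hump k.+1)).
Proof.
move=> /andP[m0n]; elim: k => [|k IHk] nmk.
  by move: m0n; rewrite ltnNge nmk.
rewrite [hump _]/= partial_sumD.
have [fn0|fn0] := eqVneq (partial_sum x n (f k.+1)) 0; last first.
  by apply: dominating_coefP => //; rewrite (leq_trans nmk)// ltnW.
(* The last term contributes nothing at order [n]; if [n] exceeds [m k], then [f k] does, by
   [f_sum]. *)
rewrite fn0 scaler0 addr0; have [/IHk //|mkn] := leqP n (m k).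
by rewrite [hump _]/= partial_sumD; apply: dominating_coefP => //; apply: f_sum.
Qed.

Lemma leq_hump_order k : (k <= m k)%N.
Proof. by elim: k => // k /leq_ltn_trans; apply. Qed.

(** A later summand [f i.+1] vanishes through [m i], and [k < i <= m i]. *)
Lemma hump_stable i k : (k < i)%N -> hump i.+1 k = hump k.+2 k.
Proof.
elim: i => // i IHi; rewrite ltnS leq_eqVlt => /predU1P[->//|ki].
rewrite -IHi// [LHS](_ : _ = hump i.+1 k +
  dominating_coef N (m i.+2) (fun n => partial_sum x n (hump i.+1))
    (fun n => partial_sum x n (f i.+1)) * f i.+1 k)//.
by rewrite f_supp ?mulr0 ?addr0// (leq_trans (ltnW ki))// leq_hump_order.
Qed.

Lemma gliding_hump (F : set (seq_space K)) :
  submod_closed (mem F) -> closed F -> (forall k, F (f k)) ->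
  exists2 g, F g & forall n, (m 0 < n)%N -> 1 <= N (partial_sum x n g).
Proof.
move=> /submod_closedP[F0 FL] Fcl Ff.
have Fhump k : F (hump k).
  by elim: k => [|k IHk] //=; rewrite addrC; apply: FL.
(* By [hump_stable] this diagonal is the coordinatewise limit of the humps. *)
exists (fun k => hump k.+2 k).
  apply: (@closed_cvg _ _ \oo _ (fun i => hump i.+1) F Fcl).
    by apply: nearW => i; exact: Fhump.
  by apply: cvg_seq_space_coordinates => k i; exact: hump_stable.
(* A partial sum of order [n] sees only the coordinates up to [n], where the limit agrees with
   [hump n.+2]. *)
move=> n m0n; rewrite (_ : partial_sum x n _ = partial_sum x n (hump n.+2)).
  by apply: hump_norm_ge1; rewrite m0n ltnW// leq_hump_order.
by apply: eq_partial_sum => k kn; rewrite -(@hump_stable n.+1).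
Qed.

End GlidingHump.

(** Density alone does not control the index, so it is applied to a punctured ball too small to
    contain any partial sum of order at most [M]. *)
Lemma universal_partial_sum_small (K : numFieldType)
    (X : topologicalLmodType K) (x : nat -> nat -> X) (N : X -> K)
    (w : X) (a : seq_space K) (M : nat) :
  continuous_norm N -> w != 0 -> universal_seqs x a ->
  exists2 n, (M < n)%N & N (partial_sum x n a) < 1.
Proof.
move=> hN w0 ua; have [N_ge0 _ NZ _ _] := hN.
(* [D^-1] is at most [1] and at most each nonzero norm listed; a zero norm contributes [0^-1 = 0]
   and is excluded by the puncture. *)
pose D : K := 1 + \sum_(n < M.+1) (N (partial_sum x n a))^-1.
have D1 : 1 <= D by rewrite lerDl sumr_ge0// => n _; rewrite invr_ge0.
have D0 : 0 < D by exact: lt_le_trans D1.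
have Nw0 := continuous_norm_gt0 hN w0.
have [||u [/= /andP[u0 uD] [n _ su]]] := ua [set u | 0 < N u < D^-1].
- exists ((D^-1 / 2 / N w) *: w) => /=; rewrite NZ ger0_norm.
    by rewrite divfK ?gt_eqF// divr_gt0 ?invr_gt0//= gtr_pMr ?invr_gt0//
      invf_lt1 ?ltr1n.
  by rewrite !divr_ge0 ?invr_ge0 ?ltW.
- by apply: open_continuous_norm_ball; rewrite ?invr_gt0.
rewrite -/(partial_sum x n a) in su; exists n; last first.
  by rewrite su (lt_le_trans uD)// invf_le1.
rewrite ltnNge; apply/negP => nM.
suff Du : D^-1 <= N u by have := lt_le_trans uD Du; rewrite ltxx.
rewrite -[X in _ <= X]invrK lef_pV2 ?posrE ?invr_gt0//.
rewrite /D (bigD1 (Ordinal (nM : n < M.+1)%N)) //= su.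
rewrite addrCA lerDl addr_ge0// sumr_ge0// => i _; rewrite invr_ge0.
exact: N_ge0.
Qed.

Unset Implicit Arguments.

Theorem proposition2p18 (R : realType) (K : numFieldType)
    (hK : K = (R : numFieldType) \/ K = (R[i]%C : numFieldType))
    (X : topologicalLmodType K) (hX : metrizable R X)
    (N : X -> K) (hN : continuous_norm N)
    (x : nat -> nat -> X)
    (hx : forall k : nat, exists y : X, x n k @[n --> \oo] --> y)
    (hE : exists2 l : nat, (1 <= l)%N & ~ dense (E_ x l)) :
  ~ spaceable (universal_seqs x).
Proof.
case: hE => l _ /existsNP[W /not_implyP[W0 /not_implyP[Wo /nonemptyPn WE]]].
move=> [F [subF Fcl Finf FU]].
have notEW w : W w -> ~ E_ x l w.
  by move=> Ww Ew; have : (W `&` E_ x l) w by []; rewrite WE.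
have pick p : exists fm : seq_space K * nat, [/\ F fm.1,
    forall j, (j < l + p)%N -> fm.1 j = 0, (l + p <= fm.2)%N &
    forall n, (fm.2 < n)%N -> partial_sum x n fm.1 != 0].
  have [a [Fa a0 aN0]] : exists a, [/\ F a,
      forall k, (k < l + p)%N -> a k = 0 & a <> 0].
    apply: contrapT => noa; apply: Finf.
    apply: (finite_dimensional_coordinates (p := (l + p)%N)) => // a Fa a0.
    by apply: contrapT => aN0; apply: noa; exists a.
  have [//|u [Wu [m _ su]]] := FU a (conj Fa aN0) W W0.
  (* Were [m] smaller, the [m]-th partial sum would be [0], which lies in [E_ x l]. *)
  have lpm : (l + p <= m)%N.
    rewrite leqNgt; apply/negP => mlp; apply: (notEW _ Wu); rewrite -su.
    have -> : \sum_(0 <= k < m.+1) a k *: x m k = 0; last exact: E_0.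
    by apply: partial_sum_below => k km; apply/a0/(leq_ltn_trans km).
  exists (a, m); split=> //= n mn; apply/eqP => sn0; apply: (notEW _ Wu).
  rewrite -su; apply: (E_partial_sum (n := n)) => //.
    by move=> k kl; apply: a0; rewrite ltn_addr.
  by rewrite mn andbT (leq_trans _ lpm)// leq_addr.
have [fm fmP] := choice pick.
(* The successor makes the next sequence vanish at the index [(fm (v i)).2] too, and makes these
   indices strictly increase. *)
pose v := fix v k := if k is i.+1 then (fm (v i)).2.+1 else 0%N.
have [||||g Fg g1] := @gliding_hump _ _ x N hN (fun k => (fm (v k)).1)
  (fun k => (fm (v k)).2) _ _ _ F subF Fcl.
- move=> k; have [_ _ lv _] := fmP (v k.+1).
  by apply: leq_trans lv; rewrite leq_addl.
- move=> k j jm; have [_ + _ _] := fmP (v k.+1); apply.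
  by rewrite ltn_addl.
- by move=> k n; have [_ _ _] := fmP (v k); apply.
- by move=> k; have [] := fmP (v k).
have [w Ww] := W0.
have w0 : w != 0.
  by apply/eqP => w0; apply: (notEW w Ww); rewrite w0; exact: E_0.
have gN0 : g <> 0.
  move=> g0; have := g1 _ (ltnSn _); rewrite g0 partial_sum0.
  have [_ _ NZ _ _] := hN.
  by rewrite -(scale0r (0 : X)) NZ normr0 mul0r ler10.
have [n mn] := universal_partial_sum_small (fm (v 0)).2 hN w0
  (FU g (conj Fg gN0)).
(* The order of [K] may be partial, so negating [<] requires the norm to be real. *)
by apply/negP; rewrite -real_leNgt ?g1// ger0_real//;
  by have [+ _ _ _ _] := hN; apply.
Qed.
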